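(* Let $n\ge 2$, $p$, $k$, $l$ be integers with $1\le p\le n-1$ and $0\le l<k\le N=\binom{n}{p}$. Let $\Omega\subset\mathbb{R}^{n}$ be a bounded domain with $C^1$ boundary and outer unit normal $\nu$, let $f$ be a positive function on $\Omega$ and let $\varphi\in C^{0}(\partial\Omega)$. Suppose that $\varepsilon\in(0,1)$ and that $u\in C^{2}(\Omega)\cap C^{1}(\overline{\Omega})$ is a $(\Lambda,k)$-admissible solution of $$\begin{cases}\dfrac{\sigma_k(\Lambda(D^2 u))}{\sigma_l(\Lambda(D^2 u))}=f(x)&\text{in }\Omega,\\[2mm] u_\nu=-\varepsilon u+\varphi(x)&\text{on }\partial\Omega.\end{cases}$$ Then $$\max_{\overline{\Omega}}|\varepsilon u|\le M_{0},$$ where $M_{0}$ depends only on $n,k,l,p,\sup_{\Omega}f,|\varphi|_{C^{0}}$ and $\Omega$.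
   Context: Let $\mathfrak{J}(p,n)$ be the set of multi-indices $I=(i_1,\dots,i_p)$ with $1\le i_1<\cdots<i_p\le n$, enumerated in a fixed order as $I_1,\dots,I_N$, $N=\binom{n}{p}$. If $\lambda_1,\dots,\lambda_n$ are the eigenvalues of the Hessian $D^2u$, put $\Lambda_I(D^2u)=\lambda_{i_1}+\cdots+\lambda_{i_p}$ and $\Lambda(D^2u)=(\Lambda_{I_1}(D^2u),\dots,\Lambda_{I_N}(D^2u))\in\mathbb{R}^N$. $\sigma_m$ is the $m$-th elementary symmetric function on $\mathbb{R}^N$, with $\sigma_0=1$. Let $\tilde\Gamma_k=\{\mu\in\mathbb{R}^N:\sigma_j(\mu)>0,\ 1\le j\le k\}$. A $C^2$ function $u$ is called $(\Lambda,k)$-admissible if $\Lambda(D^2u(x))\in\tilde\Gamma_k$ for every $x\in\Omega$. $u_\nu$ denotes the derivative of $u$ in the direction $\nu$. *)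

(* Defs.v *)
(* Built on MathComp-Analysis; points of R^n are row vectors 'rV[R]_n.  Their
   library norm is the sup norm: topology, boundedness and differentiability do
   not depend on this choice, and lengths are taken with [enorm]. *)
From HB Require Import structures.
From mathcomp Require Export all_boot all_order all_algebra.
From mathcomp Require Export all_classical all_reals all_analysis.
(* [mpoly] is not imported: its notations clash with those of analysis. *)
From mathcomp Require mpoly.
Export Order.TTheory GRing.Theory Num.Theory.
Export numFieldNormedType.Exports.

Set Implicit Arguments.
Unset Strict Implicit.
Unset Printing Implicit Defensive.

Local Open Scope classical_set_scope.
Local Open Scope ring_scope.

Section Calculus.
Context {R : realType} {n : nat}.
Implicit Types (Omega : set 'rV[R]_n) (u : 'rV[R]_n -> R) (x v : 'rV[R]_n).

Definition partial (i : 'I_n) u : 'rV[R]_n -> R :=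
  fun x => 'D_('e_i : 'rV[R]_n) u x.

Definition grad u x : 'rV[R]_n := \row_i partial i u x.

Definition hessian u x : 'M[R]_n := \matrix_(i, j) partial j (partial i u) x.

Definition enorm v : R := Num.sqrt (\sum_i v 0 i ^+ 2).

Definition C1_on Omega u : Prop :=
  forall x, Omega x ->
    differentiable u x /\ forall i, {for x, continuous (partial i u)}.

Definition C2_on Omega u : Prop :=
  C1_on Omega u /\ forall i, C1_on Omega (partial i u).

(* C^1 up to the boundary: [u] is continuous on the closure and its first
   derivatives in [Omega] extend continuously to the closure. *)
Definition C1_closure Omega u : Prop :=
  [/\ C1_on Omega u,
      {within closure Omega, continuous u} &
      forall i, exists2 g : 'rV[R]_n -> R,
        {within closure Omega, continuous g} &
        forall x, Omega x -> g x = partial i u x].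

(* The derivative in the direction [v] at a point [x] of the boundary, for [u]
   of class C^1 up to the boundary: the value at [x] of the continuous extension
   of 'D_v u.  The values of [u] outside the closure of [Omega] play no role. *)
Definition boundary_derive Omega u x v : R :=
  lim ('D_v u y @[y --> within Omega (nbhs x)]).

Definition boundary Omega : set 'rV[R]_n := closure Omega `\` interior Omega.

Definition bounded_domain Omega : Prop :=
  [/\ open Omega, Omega !=set0, connected Omega & bounded_set Omega].

Definition local_defining_function Omega (x : 'rV[R]_n) (U : set 'rV[R]_n)
    (rho : 'rV[R]_n -> R) : Prop :=
  [/\ open U, U x, C1_on U rho,
      forall y, U y -> grad rho y != 0 &
      Omega `&` U = [set y | U y /\ rho y < 0]].

Definition C1_boundary Omega : Prop :=
  forall x, boundary Omega x -> exists U rho, local_defining_function Omega x U rho.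

(* [rho] is negative inside [Omega], so its gradient points outwards. *)
Definition outer_unit_normal Omega (nu : 'rV[R]_n -> 'rV[R]_n) : Prop :=
  forall x, boundary Omega x ->
    exists U rho, local_defining_function Omega x U rho /\
      nu x = (enorm (grad rho x))^-1 *: grad rho x.

End Calculus.

Section SymmetricFunctions.
Context {R : realType}.

Definition sigma (N m : nat) (mu : 'rV[R]_N) : R :=
  mpoly.meval (fun a => mu 0 a) (mpoly.mesym N R m).

(* Strict positivity of sigma_1, ..., sigma_k. *)
Definition Gamma (N k : nat) : set 'rV[R]_N :=
  [set mu | forall j, (1 <= j <= k)%N -> 0 < sigma j mu].

(* The eigenvalues with multiplicity, in nondecreasing order; the default value
   is irrelevant for symmetric matrices, whose characteristic polynomial splits
   over the reals. *)
Definition eigenvalues (n : nat) (A : 'M[R]_n) : 'rV[R]_n :=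
  xget 0 [set l : 'rV[R]_n |
    char_poly A = \prod_i ('X - (l 0 i)%:P) /\
    forall i j : 'I_n, (i <= j)%N -> l 0 i <= l 0 j].

(* A multi-index 1 <= i_1 < ... < i_p <= n is encoded by the set of its
   entries. *)
Definition multi_indices (p n : nat) : {set {set 'I_n}} :=
  [set I : {set 'I_n} | #|I| == p].

Lemma card_multi_indices (p n : nat) : #|multi_indices p n| = 'C(n, p).
Proof. by rewrite card_draws card_ord. Qed.

Definition multi_index (p n : nat) (a : 'I_'C(n, p)) : {set 'I_n} :=
  enum_val (cast_ord (esym (card_multi_indices p n)) a).

Definition Lambda (p n : nat) (A : 'M[R]_n) : 'rV[R]_('C(n, p)) :=
  \row_a \sum_(i in multi_index a) eigenvalues A 0 i.

Definition admissible (p k n : nat) (Omega : set 'rV[R]_n) (u : 'rV[R]_n -> R) :=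
  forall x, Omega x -> Gamma k (Lambda p (hessian u x)).

End SymmetricFunctions.

(* Main.v *)
Require Import Defs.
From mathcomp Require Import lra ring.
Set Implicit Arguments.
Unset Strict Implicit.
Unset Printing Implicit Defensive.
Local Open Scope classical_set_scope.
Local Open Scope ring_scope.

(** Both bounds come from minimising w = s u + a |x|^2 over the closure.  At an
    interior minimum every eigenvalue lam of the Hessian of u satisfies
    s lam + 2 a >= 0; at a boundary minimum w is nonincreasing in the direction nu,
    i.e. s u_nu + 2 a x.nu <= 0.
    With (s, a) = (-1, 0) an interior minimum would make all eigenvalues
    nonpositive, against sigma_1 > 0, so u is maximal at a boundary point, where
    u_nu >= 0 gives eps u <= phi.
    With (s, a) = (1, -A) an interior minimum would make all eigenvalues at least
    2 A, and for A large in terms of sup f this forces sigma_k / sigma_l > sup f;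
    at a boundary minimum u_nu <= 2 A x.nu bounds eps u from below. *)

(** * First and second derivative tests *)

Lemma derive_lt0_decr {R : realType} {V : normedModType R} (u : V -> R) (x v : V) :
  derivable u x v -> 'D_v u x < 0 ->
  exists2 d : R, 0 < d & forall t, 0 < t < d -> u (x + t *: v) < u x.
Proof.
move=> du Du0.
have H := cvgr_lt _ du _ Du0.
have [d /= d0 Hd] := H _.
exists d => // t /andP[t0 td].
have := Hd t _ _; rewrite /= sub0r normrN gtr0_norm // gt_eqF // => /(_ td isT).
by rewrite /GRing.scale /= pmulr_rlt0 ?invr_gt0// subr_lt0 addrC.
Qed.

Section OneVariable.
Context {R : realType}.
Implicit Types h dh : R -> R.

(** The mean value theorem in the form used against a minimum at [0]: the derivative cannot be
    negative on all of []0, d[]. *)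
Lemma exists_derive_ge0 h dh (d : R) : 0 < d ->
  (forall t, 0 < t < d -> is_derive t 1 h (dh t)) ->
  {within `[0, d], continuous h} -> h 0 <= h d ->
  exists2 c, 0 < c < d & 0 <= dh c.
Proof.
move=> d0 hd hc hmin.
have [c cd E] : exists2 c, c \in `]0, d[%R & h d - h 0 = dh c * (d - 0).
  apply: MVT => // t; rewrite in_itv /=; exact: hd.
exists c; first by move: cd; rewrite in_itv.
by rewrite -(pmulr_lge0 _ d0) -[d in dh c * d]subr0 -E subr_ge0.
Qed.

(** If [c < 0], then [dh], which vanishes at the minimum [0], would be negative just to the right of
    [0]; [exists_derive_ge0] excludes this. *)
Lemma second_derive_ge0 h dh (c : R) :
  (\forall t \near (0 : R), is_derive (t : R) 1 h (dh t)) ->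
  is_derive (0 : R) 1 dh c ->
  (\forall t \near (0 : R), h 0 <= h t) -> 0 <= c.
Proof.
move=> hd dhc hmin.
have [e /= e0 He] : \forall t \near (0 : R), is_derive (t : R) 1 h (dh t) /\ h 0 <= h t.
  by near=> t; split; near: t.
have inball (t : R) : `|t| < e -> is_derive t 1 h (dh t) /\ h 0 <= h t.
  by move=> te; apply: He; rewrite /= sub0r normrN.
have dh0 : dh 0 = 0.
  have : is_derive (0 : R) 1 h 0.
    apply: (@derive1_at_min _ h (- e) e 0).
    - by rewrite ge0_cp // ltW.
    - move=> t; rewrite in_itv /= => /andP[t1 t2].
      by have /inball[[]] : `|t| < e by rewrite ltr_norml t1.
    - by rewrite in_itv /= e0 oppr_lt0 e0.
    - move=> t; rewrite in_itv /= => /andP[t1 t2].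
      by have /inball[] : `|t| < e by rewrite ltr_norml t1.
  move=> d0.
  have /inball[d1 _] : `|0 : R| < e by rewrite normr0.
  by rewrite -(@derive_val _ _ _ _ _ _ _ d1) (@derive_val _ _ _ _ _ _ _ d0).
rewrite leNgt; apply/negP => c0.
have [r r0 Hr] : exists2 r : R, 0 < r & forall t, 0 < t < r -> dh (0 + t *: 1) < dh 0.
  have [? dhE] := dhc.
  by apply: derive_lt0_decr; rewrite // dhE.
pose d := Num.min r e / 2.
have d0 : 0 < d by rewrite divr_gt0// lt_min r0.
have [dr de] : d < r /\ d < e.
  by apply/andP; rewrite -lt_min ltr_pdivrMr // ltr_pMr ?lt_min ?r0// ltr1n.
have [t /andP[t0 td]] : exists2 t, 0 < t < d & 0 <= dh t.
  apply: (@exists_derive_ge0 h) => //.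
  - move=> t /andP[t0 td].
    by have /inball[] : `|t| < e by rewrite gtr0_norm // (lt_trans td).
  - apply: derivable_within_continuous => t; rewrite in_itv /= => /andP[t0 td].
    by have /inball[[]] : `|t| < e by rewrite ger0_norm //; exact: le_lt_trans de.
  - by have /inball[] : `|d| < e by rewrite gtr0_norm.
apply/negP; rewrite -ltNge -dh0 -[t in dh t](_ : 0 + t *: 1 = t).
  by apply: Hr; rewrite t0 (lt_trans td dr).
by rewrite add0r [LHS]mulr1.
Unshelve. all: by end_near.
Qed.

End OneVariable.

(** * Restriction to lines and the Euclidean inner product *)

Section Lines.
Context {R : realType} {n : nat}.
Implicit Types (x y v : 'rV[R]_n) (u : 'rV[R]_n -> R).

Definition dotp x y : R := \sum_i x 0 i * y 0 i.

Lemma is_derive_line u x v (t : R) : derivable u (x + t *: v) v ->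
  is_derive t 1 (fun s : R => u (x + s *: v)) ('D_v u (x + t *: v)).
Proof.
move=> du.
have E : (fun h : R => h^-1 *:
     (((fun s : R => u (x + s *: v)) \o shift t) (h *: 1) - u (x + t *: v)))
   = (fun h : R => h^-1 *: ((u \o shift (x + t *: v)) (h *: v) - u (x + t *: v))).
  apply/funext => h /=; rewrite /shift /=; congr (_ *: (u _ - _)).
  by rewrite scalerDl [h *: 1]mulr1 addrCA.
by split; rewrite /derivable /derive E.
Qed.

Lemma derive_partial u x v : differentiable u x ->
  'D_v u x = \sum_i v 0 i * partial i u x.
Proof.
move=> du; rewrite deriveE// [in LHS](row_sum_delta v) linear_sum /=.
apply: eq_bigr => i _; rewrite linearZ /=; congr (_ * _).
by rewrite /partial deriveE.
Qed.

Lemma dotp_line x v (t : R) : dotp (x + t *: v) (x + t *: v) =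
  dotp x x + 2 * t * dotp x v + t ^+ 2 * dotp v v.
Proof.
rewrite /dotp !mulr_sumr -!big_split /=; apply: eq_bigr => i _.
by rewrite !mxE; ring.
Qed.

Lemma is_derive_dotp_line x v (t : R) :
  is_derive t 1 (fun s : R => dotp (x + s *: v) (x + s *: v))
    (2 * dotp x v + 2 * t * dotp v v).
Proof.
(* Written as a polynomial in [s], the function is differentiated algebraically. *)
rewrite (_ : (fun s : R => _) =
  horner (dotp x x)%:P + horner ((2 * dotp x v) *: 'X) +
  horner (dotp v v *: 'X^2)); last first.
  by apply/funext => s; rewrite dotp_line !fctE !hornerE /=; ring.
apply: is_derive_eq; rewrite !poly.derivE !hornerE /=; ring.
Qed.

Lemma continuous_dotp : continuous (fun x : 'rV[R]_n => dotp x x).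
Proof.
apply: (continuous_big add_continuous) => i _ x.
by apply: continuousM; exact: coord_continuous.
Qed.

Lemma dotp_ge0 x : 0 <= dotp x x.
Proof. by apply: sumr_ge0 => i _; rewrite -expr2 sqr_ge0. Qed.

Lemma dotp_gt0 x : x != 0 -> 0 < dotp x x.
Proof.
move=> x0; rewrite lt_neqAle dotp_ge0 andbT eq_sym; apply: contra x0.
rewrite psumr_eq0 => [/allP H|i _]; last by rewrite -expr2 sqr_ge0.
apply/eqP/rowP => i; have := H i (mem_index_enum _).
by rewrite /= mulf_eq0 orbb mxE => /eqP.
Qed.

Lemma dotp_le x y : 2 * dotp x y <= dotp x x + dotp y y.
Proof.
rewrite /dotp mulr_sumr -big_split; apply: ler_sum => i _ /=.
rewrite -subr_ge0 (_ : _ - _ = (x 0 i - y 0 i) ^+ 2) ?sqr_ge0 //; ring.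
Qed.

Lemma dotp_unit x : x != 0 -> dotp ((enorm x)^-1 *: x) ((enorm x)^-1 *: x) = 1.
Proof.
move=> /dotp_gt0 x0.
have E : enorm x ^+ 2 = dotp x x.
  rewrite /enorm sqr_sqrtr; last by apply: sumr_ge0 => i _; exact: sqr_ge0.
  by apply: eq_bigr => i _; rewrite expr2.
rewrite [LHS](_ : _ = (enorm x ^+ 2)^-1 * dotp x x); first by rewrite E mulVf// gt_eqF.
rewrite /dotp mulr_sumr; apply: eq_bigr => i _; rewrite !mxE -exprVn; ring.
Qed.

Lemma cvg_line x v (t : R) :
  (x + s *: v) @[s --> t] --> x + t *: v.
Proof. by apply: cvgD; [exact: cvg_cst|exact: scalel_continuous]. Qed.

Lemma within_continuous_line (A : set 'rV[R]_n) u x v (d : R) :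
  {within A, continuous u} ->
  (forall t, 0 <= t <= d -> A (x + t *: v)) ->
  {within `[0, d], continuous (fun t : R => u (x + t *: v))}.
Proof.
move=> /subspace_continuousP uA Av; apply/subspace_continuousP => t td.
have At : A (x + t *: v) by apply: Av; move: td; rewrite /= in_itv.
apply: cvg_trans (uA _ At) => P /= HP.
have H : \forall s \near t, A (x + s *: v) -> P (u (x + s *: v)).
  exact: (@cvg_line x v t _ HP).
apply: filterS H => s Hs sd; apply: Hs.
by apply: Av; move: sd; rewrite /= in_itv.
Qed.

End Lines.

(** * Conditions satisfied at interior and boundary minima *)

Section Boundary.
Context {R : realType} {n : nat}.
Implicit Types (Omega : set 'rV[R]_n) (x v : 'rV[R]_n) (u : 'rV[R]_n -> R).

(** Along [- (c *: grad rho x)] the function [rho] has derivative -c |grad rho x|^2 < 0, so it drops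
    below [rho x <= 0], and negative values of [rho] in [U] mean points of [Omega]. *)
Lemma inward_segment Omega x U rho (c : R) : 0 < c ->
  boundary Omega x -> local_defining_function Omega x U rho ->
  exists2 d : R, 0 < d & forall t, 0 < t < d ->
    Omega (x + t *: - (c *: grad rho x)).
Proof.
move=> c0 [clx _] [Uo Ux rho1 rho0 OU].
have [drho _] := rho1 _ Ux.
set v := - _.
have rhox : rho x <= 0.
  (* Otherwise [rho] is positive on a neighbourhood of [x], which meets [Omega] because [x] lies in
     its closure. *)
  rewrite leNgt; apply/negP => rhox.
  have : \forall y \near x, U y /\ 0 < rho y.
    apply: filterI; first exact: open_nbhs_nbhs.
    exact: (cvgr_gt _ (differentiable_continuous drho)).
  move=> /clx [y [Oy [Uy]]].
  have : (Omega `&` U) y by [].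
  by rewrite OU => -[_] /lt_trans h /h; rewrite ltxx.
have Dv : 'D_v rho x < 0.
  have -> : 'D_v rho x = - (c * dotp (grad rho x) (grad rho x)).
    rewrite derive_partial // /dotp mulr_sumr -sumrN; apply: eq_bigr => i _.
    by rewrite !mxE mulNr mulrA.
  by rewrite oppr_lt0 mulr_gt0 // dotp_gt0 // rho0.
have [d d0 Hd] := derive_lt0_decr (diff_derivable drho) Dv.
have [e /= e0 He] : \forall t \near (0 : R), U (x + t *: v).
  by apply: cvg_line; rewrite scale0r addr0; exact: open_nbhs_nbhs.
exists (Num.min d e); first by rewrite lt_min d0.
move=> t /andP[t0]; rewrite lt_min => /andP[td te].
suff [] : (Omega `&` U) (x + t *: v) by [].
rewrite OU; split; first by apply: He; rewrite /= sub0r normrN gtr0_norm.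
by apply: lt_le_trans rhox; apply: Hd; rewrite t0.
Qed.

(** Ensures that the [lim] defining [boundary_derive] is a true limit and not a default value: 'D_v
    u is a fixed linear combination of the partial derivatives, and these extend continuously to the
    closure. *)
Lemma boundary_derive_cvg Omega u x v : closure Omega x ->
  C1_closure Omega u ->
  'D_v u y @[y --> within Omega (nbhs x)] --> boundary_derive Omega u x v.
Proof.
move=> clx [u1 _ gradu].
have /choice[l Hl] : forall i, exists l : R,
    partial i u y @[y --> within Omega (nbhs x)] --> l.
  move=> i; have [g /subspace_continuousP cg gE] := gradu i.
  exists (g x) => P /(cg _ clx) gP.
  have H : \forall y \near x, closure Omega y -> P (g y) := gP.
  apply: filterS H => y Hy Oy /=; rewrite -gE//.
  by apply: Hy; exact: subset_closure.
have Fx : ProperFilter (within Omega (nbhs x)) by exact: within_nbhs_proper.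
have H : 'D_v u y @[y --> within Omega (nbhs x)] --> \sum_i v 0 i * l i.
  apply: (@cvg_trans _ ((\sum_i v 0 i * partial i u y) @[y --> within Omega (nbhs x)])).
    apply: near_eq_cvg; apply: (@filterS _ (nbhs x) _ setT); last exact: filterT.
    move=> y _ Oy; rewrite -derive_partial//.
    by have [] := u1 _ Oy.
  apply: (cvg_big add_continuous) => i _.
  by apply: cvgMr; exact: Hl.
by rewrite /boundary_derive (cvg_lim _ H).
Qed.

Section MinimumPrinciple.
Variables (Omega : set 'rV[R]_n) (u : 'rV[R]_n -> R) (s a : R).

Let w y := s * u y + a * dotp y y.

Let w_line (x v : 'rV[R]_n) (t : R) : differentiable u (x + t *: v) ->
  is_derive t 1 (fun r : R => w (x + r *: v))
    (s * 'D_v u (x + t *: v) + a * (2 * dotp x v + 2 * t * dotp v v)).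
Proof.
move=> du.
have d1 := is_derive_line (diff_derivable du).
have d2 := is_derive_dotp_line x v t.
exact: (is_deriveD (is_deriveZ s d1) (is_deriveZ a d2)).
Qed.

(** On the line through [x] along an eigenvector [v], the second derivative of [w] at [x] is (s lam
    + 2 a) |v|^2. *)
Lemma hessian_eigenvalue_min (x : 'rV[R]_n) (lam : R) :
  open Omega -> C2_on Omega u -> Omega x -> (forall y, Omega y -> w x <= w y) ->
  eigenvalue (hessian u x) lam -> 0 <= s * lam + 2 * a.
Proof.
move=> Oo [u1 u2] Ox wmin /eigenvalueP[v vH v0].
have near_line : \forall t \near (0 : R), Omega (x + t *: v).
  by apply: cvg_line; rewrite scale0r addr0; exact: open_nbhs_nbhs.
pose dh t := s * (\sum_i v 0 i * partial i u (x + t *: v)) +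
  a * (2 * dotp x v + 2 * t * dotp v v).
suff : 0 <= (s * lam + 2 * a) * dotp v v.
  by rewrite pmulr_lge0 // dotp_gt0.
apply: (@second_derive_ge0 _ (fun t => w (x + t *: v)) dh).
- apply: filterS near_line => t Ot.
  rewrite /dh -derive_partial; first exact: w_line (u1 _ Ot).1.
  exact: (u1 _ Ot).1.
- have dp i : is_derive (0 : R) 1 (fun t : R => v 0 i * partial i u (x + t *: v))
      (v 0 i * \sum_j v 0 j * hessian u x i j).
    have := is_derive_line (x := x) (v := v) (t := 0) (u := partial i u).
    rewrite scale0r addr0 => H.
    have du := (u2 i x Ox).1.
    have {}H := H (diff_derivable du).
    have := is_deriveZ (v 0 i) H; rewrite derive_partial//.
    (* Here [mxE] is run backwards, to recognise the second partial derivative as an entry of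
       [hessian u x]. *)
    by under eq_bigr do
      rewrite -[partial _ _ _](mxE matrix_key (fun i j => partial j (partial i u) x)).
  have dq : is_derive (0 : R) 1 (fun t : R => 2 * dotp x v + 2 * t * dotp v v)
      (2 * dotp v v).
    rewrite (_ : (fun t : R => _) =
      horner ((2 * dotp x v)%:P + (2 * dotp v v) *: 'X)); last first.
      by apply/funext => t; rewrite !hornerE /=; ring.
    by apply: is_derive_eq; rewrite !poly.derivE !hornerE /=.
  rewrite (_ : dh = (fun t =>
      s *: (\sum_i (fun t : R => v 0 i * partial i u (x + t *: v))) t
      + a *: (2 * dotp x v + 2 * t * dotp v v))); last first.
    by apply/funext => t; rewrite fct_sumE.
  apply: is_derive_eq
    (is_deriveD (is_deriveZ s (is_derive_sum dp)) (is_deriveZ a dq)) _.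
  (* After exchanging the sums, the inner one is entry [j] of [v *m hessian u x], that is, lam
     v_j. *)
  have -> : \sum_i v 0 i * (\sum_j v 0 j * hessian u x i j) = lam * dotp v v.
    under eq_bigr do rewrite mulr_sumr.
    rewrite exchange_big /dotp mulr_sumr; apply: eq_bigr => j _ /=.
    have := congr1 (fun z : 'rV_n => z 0 j) vH; rewrite !mxE => E.
    rewrite mulrA -E mulr_suml; apply: eq_bigr => i _; rewrite mulrCA mulrC; ring.
  by rewrite /GRing.scale /=; ring.
- apply: filterS near_line => t Ot; rewrite scale0r addr0; exact: wmin.
Qed.

(** Since [u] need not be differentiable at [x] itself, the derivative of [w] is taken at interior
    points of the inward normal segment and passed to the limit; a negative limit would contradict
    minimality through the mean value theorem. *)
Lemma boundary_derive_min (nu : 'rV[R]_n -> 'rV[R]_n) (x : 'rV[R]_n) :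
  C1_closure Omega u -> outer_unit_normal Omega nu ->
  boundary Omega x -> (forall y, closure Omega y -> w x <= w y) ->
  s * boundary_derive Omega u x (nu x) + 2 * a * dotp x (nu x) <= 0.
Proof.
move=> u1 nuO bx wmin.
have clx := bx.1.
have [U [rho [Urho nuE]]] := nuO _ bx.
have [_ Ux _ /(_ x Ux) grho0 _] := Urho.
have e0 : 0 < (enorm (grad rho x))^-1.
  rewrite invr_gt0 sqrtr_gt0; have := dotp_gt0 grho0.
  by rewrite /dotp; under eq_bigr do rewrite -expr2.
have [d d0 Hd] := inward_segment e0 bx Urho.
rewrite -nuE in Hd; set v := nu x in Hd *.
(* The derivative of [w] along the inward segment, with the sign pulled out of the direction so that
   [boundary_derive_cvg] applies to [v]. *)
pose dh t := - (s * 'D_v u (x + t *: - v)) +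
   a * (- (2 * dotp x v) + 2 * t * dotp v v).
have wcont : {within closure Omega, continuous w}.
  have [_ cu _] := u1.
  move=> y; apply: cvgD; first by apply: cvgMr; exact: cu.
  by apply: cvgMr; apply: (continuous_subspaceT continuous_dotp).
have dhlim : dh t @[t --> 0^'+] -->
    - (s * boundary_derive Omega u x v) + a * (- (2 * dotp x v) + 2 * 0 * dotp v v).
  apply: cvgD.
    apply: cvgN; apply: cvgMr.
    move=> P /(boundary_derive_cvg (v := v) clx u1) HP.
    have H : \forall t \near (0 : R), Omega (x + t *: - v) -> P ('D_v u (x + t *: - v)).
      apply: (@cvg_line _ _ x (- v) 0 [set y | Omega y -> P ('D_v u y)]).
      by rewrite scale0r addr0; exact: HP.
    have [e /= e0' He] := H.
    exists (Num.min d e) => /=; first by rewrite lt_min d0.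
    move=> t /=; rewrite sub0r normrN lt_min => /andP[td te] t0.
    by apply: He => //=; [rewrite sub0r normrN|apply: Hd; rewrite t0 -(gtr0_norm t0)].
  apply: cvgMr; apply: cvgD; first exact: cvg_cst.
  by apply: cvgMl; apply: cvgMr; apply: cvg_within.
rewrite leNgt; apply/negP => H.
have [|e /= e0' He] := cvgr_lt _ dhlim 0 _; first by lra.
pose r := Num.min d e / 2.
have r0 : 0 < r by rewrite divr_gt0// lt_min d0.
have [rd re] : r < d /\ r < e.
  by apply/andP; rewrite -lt_min ltr_pdivrMr // ltr_pMr ?lt_min ?d0// ltr1n.
have Ov t : 0 < t < d -> Omega (x + t *: - v) by exact: Hd.
have [t /andP[t0 tr]] : exists2 t, 0 < t < r & 0 <= dh t.
  apply: (@exists_derive_ge0 _ (fun t => w (x + t *: - v))) => //.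
  - move=> t /andP[t0 tr].
    have Ot : Omega (x + t *: - v) by apply: Ov; rewrite t0 (lt_trans tr).
    have [u1' _ _] := u1; have du := (u1' _ Ot).1.
    apply: is_derive_eq (w_line du) _; rewrite /dh.
    have -> : 'D_(- v) u (x + t *: - v) = - 'D_v u (x + t *: - v).
      by rewrite !deriveE// linearN.
    have -> : dotp x (- v) = - dotp x v.
      by rewrite /dotp -sumrN; apply: eq_bigr => i _; rewrite mxE mulrN.
    have -> : dotp (- v) (- v) = dotp v v.
      by apply: eq_bigr => i _; rewrite mxE mulrNN.
    by ring.
  - apply: (within_continuous_line wcont) => t /andP[t0 tr].
    move: t0; rewrite le_eqVlt => /predU1P[<-|t0]; first by rewrite scale0r addr0.
    by apply: subset_closure; apply: Ov; rewrite t0 (le_lt_trans tr).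
  - rewrite scale0r addr0; apply: wmin.
    by apply: subset_closure; apply: Ov; rewrite r0.
apply/negP; rewrite -ltNge; apply: He => //=.
by rewrite sub0r normrN gtr0_norm // (lt_trans tr).
Qed.
End MinimumPrinciple.

End Boundary.

(** * Elementary symmetric functions *)

Section Sigma.
Context {R : realType} {N : nat}.
Implicit Types mu : 'rV[R]_N.

Lemma sigmaE m mu :
  sigma m mu = \sum_(S : {set 'I_N} | #|S| == m) \prod_(i in S) mu 0 i.
Proof.
rewrite /sigma mpoly.mesymE (big_morph _ (mpoly.mevalD _) (mpoly.meval0 _)).
apply: eq_bigr => S _.
rewrite mpoly.mevalX [RHS]big_mkcond /=; apply: eq_bigr => i _.
by rewrite mpoly.mnmE; case: (i \in S); rewrite ?expr1 ?expr0.
Qed.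

Lemma sigma1E mu : sigma 1 mu = \sum_i mu 0 i.
Proof.
rewrite /sigma mpoly.mesym1E (big_morph _ (mpoly.mevalD _) (mpoly.meval0 _)).
by apply: eq_bigr => i _; rewrite mpoly.mevalXU.
Qed.

Lemma exists_superset_card (T : {set 'I_N}) k :
  (#|T| < k)%N -> (k <= N)%N -> exists2 S : {set 'I_N}, T \proper S & #|S| = k.
Proof.
move=> Tk kN.
(* The sets that can be added to [T] are counted by a binomial coefficient, positive because
   [k <= N]. *)
have : (0 < #|[set A : {set 'I_N} | A \subset ~: T & #|A| == (k - #|T|)%N]|)%N.
  by rewrite cards_draws bin_gt0 (cardsCs (~: T)) finset.setCK card_ord leq_sub2r.
case/card_gt0P => A; rewrite inE => /andP[AT /eqP cA].
have cTA : #|T :|: A| = k.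
  rewrite finset.cardsU cA (_ : T :&: A = finset.set0) ?cards0 ?subn0 ?subnKC 1?ltnW//.
  apply/eqP; rewrite finset.setI_eq0 disjoint_sym.
  by move: AT; rewrite finset.subsets_disjoint finset.setCK.
exists (T :|: A) => //.
by rewrite properEcard finset.subsetUl cTA.
Qed.

(* Each product over an l-subset, times [B], is at most the product over some
   k-superset, hence at most sigma_k; there are 'C(N, l) such products. *)
Lemma sigma_ge (B : R) k l mu : 1 <= B -> (l < k)%N -> (k <= N)%N ->
  (forall i, B <= mu 0 i) -> B * sigma l mu <= 'C(N, l)%:R * sigma k mu.
Proof.
move=> B1 lk kN Bmu.
have mu1 i : 1 <= mu 0 i by exact: le_trans (Bmu i).
have mu0 i : 0 <= mu 0 i by exact: le_trans (mu1 i).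
have prod1 (A : pred 'I_N) : 1 <= \prod_(i | A i) mu 0 i.
  by elim/big_ind: _ => // x y x1 y1; exact: mulr_ege1.
rewrite !sigmaE mulr_sumr mulr_natl.
rewrite -(_ : #|[set T : {set 'I_N} | #|T| == l]%SET| = 'C(N, l)); last first.
  by rewrite card_draws card_ord.
rewrite -sumr_const.
rewrite [leRHS](eq_bigl (fun T : {set 'I_N} => #|T| == l)); last first.
  by move=> T; rewrite inE.
apply: ler_sum => T /eqP cT.
have [|S TS cS] := @exists_superset_card T k _ kN; first by rewrite cT.
apply: (@le_trans _ _ (\prod_(i in S) mu 0 i)).
  have /properP[sTS [j jS jT]] := TS.
  rewrite [leRHS](bigID (mem T)) /= [leRHS]mulrC.
  rewrite [X in _ <= _ * X](eq_bigl (mem T)); last first.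
    move=> i /=; apply/andP/idP => [[]//|iT]; split=> //.
    exact: (fintype.subsetP sTS).
  apply: ler_wpM2r; first exact: prodr_ge0.
  (* Of the extra factors, the one at [j] supplies [B] and all others are at least 1. *)
  rewrite (bigD1 j) /=; last by rewrite jS.
  by apply: le_trans (Bmu j) _; apply: ler_peMr.
rewrite [leRHS](bigD1 S) /=; last by rewrite cS.
by rewrite lerDl; apply: sumr_ge0 => *; exact: prodr_ge0.
Qed.

Lemma sigma_gt0 l mu : (l <= N)%N -> (forall i, 0 < mu 0 i) -> 0 < sigma l mu.
Proof.
move=> lN mu0; rewrite sigmaE.
have : (0 < #|[set A : {set 'I_N} | #|A| == l]%SET|)%N.
  by rewrite card_draws card_ord bin_gt0.
case/card_gt0P => A; rewrite inE => cA.
rewrite (bigD1 A) //= ltr_pwDl ?prodr_gt0//.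
by apply: sumr_ge0 => *; apply: prodr_ge0 => *; exact: ltW.
Qed.
End Sigma.

(** * Eigenvalues of the Hessian and their sums *)

Section Eigenvalues.
Context {R : realType} {n : nat}.

(* The spectral theorem is not needed: if the characteristic polynomial did not
   split, [eigenvalues A] would be the default value 0, against sigma_1 > 0. *)
Lemma admissible_eigenvalue (p k : nat) (A : 'M[R]_n) : (0 < k)%N ->
  Gamma k (Lambda p A) -> forall i, eigenvalue A (eigenvalues A 0 i).
Proof.
move=> k0 /(_ 1%N); rewrite /= k0 => /(_ isT); rewrite sigma1E => s1 i.
rewrite eigenvalue_root_char.
have [[l Hl]|Hn] := pselect (exists l : 'rV[R]_n,
    char_poly A = \prod_i ('X - (l 0 i)%:P) /\
    forall i j : 'I_n, (i <= j)%N -> l 0 i <= l 0 j); last first.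
  move: s1; rewrite big1 ?ltxx// => a _; rewrite mxE big1// => j _.
  by rewrite /eigenvalues xgetPN ?mxE// => l Hl; apply: Hn; exists l.
have [-> _] : char_poly A = \prod_i ('X - (eigenvalues A 0 i)%:P) /\
    forall i j : 'I_n, (i <= j)%N -> eigenvalues A 0 i <= eigenvalues A 0 j.
  by rewrite /eigenvalues; case: xgetP => [_ _ //|/(_ l)].
by rewrite (bigD1 i) //= rootM root_XsubC eqxx.
Qed.

(** As [0 < p], each sum has a term, which is at least [B]; the remaining terms are nonnegative. *)
Lemma Lambda_ge (p : nat) (A : 'M[R]_n) (B : R) : (0 < p)%N -> 0 <= B ->
  (forall i, B <= eigenvalues A 0 i) -> forall a, B <= Lambda p A 0 a.
Proof.
move=> p0 B0 BA a; rewrite mxE.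
have ca : #|multi_index a| = p.
  have := enum_valP (cast_ord (esym (card_multi_indices p n)) a).
  by rewrite inE => /eqP.
have /card_gt0P[i ia] : (0 < #|multi_index a|)%N by rewrite ca.
rewrite (bigD1 i) //= -[B]addr0; apply: lerD => //.
by apply: sumr_ge0 => j _; exact: le_trans (BA j).
Qed.
End Eigenvalues.

(** * Compactness and attained minima *)

Lemma bounded_compact_closure {R : realType} {n : nat} (A : set 'rV[R]_n) :
  bounded_set A -> compact (closure A).
Proof.
move=> [M [Mreal AM]].
apply: bounded_closed_compact; last exact: closed_closure.
exists M; split=> // N MN y /= cAy.
suff : closure [set z : 'rV[R]_n | `|z| <= N] y.
  rewrite -(proj1 (closure_id _)) //.
  apply: (closed_comp (f := fun z : 'rV[R]_n => `|z|) (D := [set t | t <= N])).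
    by move=> z _; exact: norm_continuous.
  exact: closed_le.
exact: closure_subset (AM _ MN) _ cAy.
Qed.

Lemma bounded_compact_boundary {R : realType} {n : nat} (A : set 'rV[R]_n) :
  bounded_set A -> compact (boundary A).
Proof.
move=> bA; rewrite /boundary setDE; apply: compact_closedI.
  exact: bounded_compact_closure.
by apply: open_closedC; exact: open_interior.
Qed.

(** Compactness bounds the set of values, so that [sup] is a genuine upper bound. *)
Lemma compact_le_sup_norm {R : realType} {T : topologicalType} (A : set T)
    (g : T -> R) :
  compact A -> {within A, continuous g} ->
  forall x, A x -> `|g x| <= sup [set `|g y| | y in A].
Proof.
move=> cA cg x Ax; apply: ub_le_sup; last by exists x.
have /compact_bounded[M [_ HM]] := continuous_compact cg cA.
exists (M + 1) => _ [y Ay <-].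
by apply: (HM (M + 1)); [rewrite ltrDl|exists y].
Qed.

(** A minimum exists by compactness of the closure; as [Omega] is open, a minimum point outside it
    is a boundary point. *)
Lemma minimum_principle {R : realType} {n : nat} (Omega : set 'rV[R]_n)
    (nu : 'rV[R]_n -> 'rV[R]_n) (u : 'rV[R]_n -> R) (s a : R) :
  bounded_domain Omega -> outer_unit_normal Omega nu ->
  C2_on Omega u -> C1_closure Omega u ->
  exists x, [/\ closure Omega x,
    forall y, closure Omega y ->
      s * u x + a * dotp x x <= s * u y + a * dotp y y &
    (Omega x /\ forall lam, eigenvalue (hessian u x) lam -> 0 <= s * lam + 2 * a) \/
    (boundary Omega x /\
       s * boundary_derive Omega u x (nu x) + 2 * a * dotp x (nu x) <= 0)].
Proof.
move=> [Oo [z Oz] _ Ob] nuO u2 u1.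
have [_ cu _] := u1.
have wcont : {within closure Omega, continuous (fun y => s * u y + a * dotp y y)}.
  move=> y; apply: cvgD; first by apply: cvgMr; exact: cu.
  by apply: cvgMr; apply: (continuous_subspaceT (@continuous_dotp R n)).
have [|x] := EVT_min_rV _ (bounded_compact_closure Ob) wcont.
  by exists z; exact: subset_closure.
rewrite inE => clx xmin.
have {}xmin y : closure Omega y -> s * u x + a * dotp x x <= s * u y + a * dotp y y.
  by move=> cly; apply: xmin; rewrite inE.
exists x; split => //.
have [Ox|nOx] := pselect (Omega x); [left|right].
  split => // lam; apply: (hessian_eigenvalue_min Oo u2 Ox) => y Oy.
  by apply: xmin; exact: subset_closure.
have bx : boundary Omega x.
  by split => //; move: Oo => /interior_id ->.
by split => //; exact: (boundary_derive_min u1 nuO bx).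
Qed.

(** * The estimate itself *)

Lemma outer_unit_normal_dotp {R : realType} {n : nat} (Omega : set 'rV[R]_n)
    (nu : 'rV[R]_n -> 'rV[R]_n) x :
  outer_unit_normal Omega nu -> boundary Omega x -> dotp (nu x) (nu x) = 1.
Proof.
move=> /[apply] -[U [rho [[_ Ux _ rho0 _] ->]]].
by apply: dotp_unit; exact: rho0.
Qed.

Theorem theorem3p1 (R : realType) (n p k l : nat)
    (hn : (2 <= n)%N) (hp : (1 <= p <= n - 1)%N)
    (hlk : (l < k)%N) (hkN : (k <= 'C(n, p))%N)
    (Omega : set 'rV[R]_n) (hO : bounded_domain Omega) (hbO : C1_boundary Omega) :
  exists M0 : R -> R -> R,
    forall (nu : 'rV[R]_n -> 'rV[R]_n) (f phi u : 'rV[R]_n -> R) (eps : R),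
      outer_unit_normal Omega nu ->
      (forall x, Omega x -> 0 < f x) ->
      has_ubound (f @` Omega) ->
      {within boundary Omega, continuous phi} ->
      0 < eps < 1 ->
      C2_on Omega u ->
      C1_closure Omega u ->
      admissible p k Omega u ->
      (forall x, Omega x ->
         sigma k (Lambda p (hessian u x)) / sigma l (Lambda p (hessian u x))
         = f x) ->
      (forall x, boundary Omega x ->
         boundary_derive Omega u x (nu x) = - eps * u x + phi x) ->
      forall x, closure Omega x ->
        `|eps * u x| <= M0 (sup (f @` Omega))
                           (sup [set `|phi y| | y in boundary Omega]).
Proof.
have p0 : (0 < p)%N by case/andP: hp.
have k0 : (0 < k)%N by exact: leq_ltn_trans hlk.
have [Oo _ _ Ob] := hO.
pose Q := sup [set `|dotp y y| | y in closure Omega].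
have HQ y : closure Omega y -> dotp y y <= Q.
  move=> cly; rewrite -[leLHS]ger0_norm ?dotp_ge0//.
  apply: (@compact_le_sup_norm _ _ _ (fun y => dotp y y)) => //.
    exact: bounded_compact_closure.
  exact: continuous_subspaceT (@continuous_dotp R n).
(* The binomial factor is the one lost in [sigma_ge]; the summand 1 makes the final comparison
   strict and gives the bound [1 <= A F] which that lemma requires. *)
pose A (F : R) : R := 1 + 'C('C(n, p), l)%:R * `|F|.
(* Of the factor 2 Q + 1, Q + 1 bounds 2 y.nu on the boundary and Q bounds the change of |y|^2
   between two points of the closure. *)
exists (fun F P : R => P + A F * (2 * Q + 1)) => nu f phi u eps nuO f0 fub cphi
  /andP[eps0 eps1] u2 u1 uadm ueq ubd x clx.
set F := sup (f @` Omega); set P := sup _.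
have phiP y : boundary Omega y -> `|phi y| <= P.
  exact: (compact_le_sup_norm (bounded_compact_boundary Ob) cphi).
have A1 : 1 <= A F by rewrite lerDl mulr_ge0.
have A0 : 0 <= A F by exact: le_trans A1.
have Q0 : 0 <= Q by exact: le_trans (dotp_ge0 x) (HQ _ clx).
have eig y : Omega y -> forall i,
    eigenvalue (hessian u y) (eigenvalues (hessian u y) 0 i).
  by move=> Oy; apply: admissible_eigenvalue k0 _; exact: uadm.
rewrite ler_norml; apply/andP; split; last first.
  (* Upper bound, from a maximum point [y] of [u]. *)
  have [y [cly ymin [[Oy Hy]|[By Hy]]]] := minimum_principle (-1) 0 hO nuO u2 u1.
    have := uadm y Oy 1%N; rewrite /= k0 => /(_ isT).
    rewrite sigma1E ltNge => /negP[].
    apply: sumr_le0 => j _; rewrite mxE; apply: sumr_le0 => i _.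
    by have := Hy _ (eig y Oy i); lra.
  have := ymin _ clx; have := phiP _ By; rewrite ler_norml => /andP[_ Hphi] Hu.
  have uyx : u x <= u y by lra.
  have : eps * u x <= eps * u y by rewrite ler_pM2l.
  have : 0 <= A F * (2 * Q + 1) by apply: mulr_ge0 => //; lra.
  move: Hy; rewrite ubd//; lra.
(* Lower bound, from a minimum point [y] of u - A |y|^2. *)
have [y [cly ymin [[Oy Hy]|[By Hy]]]] := minimum_principle 1 (- A F) hO nuO u2 u1.
  have LA i : A F <= Lambda p (hessian u y) 0 i.
    apply: Lambda_ge => // j.
    by have := Hy _ (eig y Oy j); lra.
  have L0 i : 0 < Lambda p (hessian u y) 0 i.
    by apply: lt_le_trans (LA i); exact: lt_le_trans A1.
  have := sigma_ge A1 hlk hkN LA.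
  have sl0 : 0 < sigma l (Lambda p (hessian u y)).
    by apply: sigma_gt0 => //; exact: leq_trans (ltnW hlk) hkN.
  (* Division by sigma_l turns [sigma_ge] into A <= C(N, l) f(y), whereas A = 1 + C(N, l) |F| and
     f(y) <= |F|. *)
  rewrite -ler_pdivlMr// -mulrA ueq// leNgt => /negP[].
  have fF : f y <= `|F|.
    apply: le_trans (ler_norm F); apply: ub_le_sup => //; by exists y.
  have := ler_wpM2l (ler0n R 'C('C(n, p), l)) fF.
  by rewrite /A; lra.
have := phiP _ By; rewrite ler_norml => /andP[Hphi _].
have := HQ _ clx; have := HQ _ cly; have := dotp_ge0 x; have := dotp_ge0 y.
have := dotp_le y (nu y); rewrite (outer_unit_normal_dotp nuO By).
have := ymin _ clx; move: Hy; rewrite ubd//.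
move=> h1 h2 h3 h4 h5 h6 h7.
(* The boundary condition gives eps u(y) >= phi(y) - 2 A y.nu >= - P - A (Q + 1); minimality gives
   u(y) - u(x) <= A Q, and [eps < 1] lets this cost at most another A Q. *)
have e1 : A F * (2 * dotp y (nu y)) <= A F * (Q + 1).
  by apply: ler_wpM2l => //; lra.
have e2 : A F * dotp y y <= A F * Q by exact: ler_wpM2l.
have e3 : 0 <= A F * dotp x x by exact: mulr_ge0.
have e4 : eps * (u y - u x) <= eps * (A F * Q).
  by apply: ler_wpM2l; [exact: ltW|lra].
have e5 : eps * (A F * Q) <= 1 * (A F * Q).
  by apply: ler_wpM2r; [exact: mulr_ge0|exact: ltW].
by lra.
Qed.
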